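(* Let $\mathcal{A}$ be a small abelian length category and let $N_1,N_2,\dots,N_m$ be a complete forward hom-orthogonal sequence in $\mathcal{A}$. Put $N_0=0$ and $\mathcal{G}_i=\mathcal{G}(N_0\oplus N_1\oplus\cdots\oplus N_i)$ for $0\le i\le m$. Then: (i) $\mathcal{G}_i=Filt(N_0,N_1,\dots,N_i)$ for each $0\le i\le m$; (ii) for each $1\le i\le m$, $N_i$ is a minimal extending object of $\mathcal{G}_{i-1}$ satisfying $\mathcal{G}_i=Filt(\mathcal{G}_{i-1}\cup\{N_i\})$; (iii) the sequence $0=\mathcal{G}_0\lessdot\mathcal{G}_1\lessdot\mathcal{G}_2\lessdot\cdots\lessdot\mathcal{G}_m=\mathcal{A}$ is a maximal green sequence in $\mathcal{A}$.
   Context: An abelian length category is an abelian category in which every object has finite length. For an object $N$, $N^{\perp}=\{X\in\mathcal{A}:\mathrm{Hom}(N,X)=0\}$; for a subcategory $\mathcal{C}$, ${}^{\perp}\mathcal{C}=\{X\in\mathcal{A}:\mathrm{Hom}(X,Y)=0\ \forall Y\in\mathcal{C}\}$; and $\mathcal{G}(N)={}^{\perp}(N^{\perp})$. A brick is an object whose endomorphism ring is a division ring. For a set (or class) $\mathcal{S}$ of objects, $Filt(\mathcal{S})$ is the full subcategory of objects having a finite filtration whose subquotients are isomorphic to indecomposable objects of $\mathcal{S}$; $Filt(N_0,\dots,N_i)$ means $Filt(\{N_0,\dots,N_i\})$ (so $Filt(N_0)=0$ for $N_0=0$). A complete forward hom-orthogonal sequence in $\mathcal{A}$ is a finite sequence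 of bricks $N_1,\dots,N_m$ such that (i) $\mathrm{Hom}(N_i,N_j)=0$ for all $1\le i<j\le m$; (ii) the sequence is maximal in $\mathcal{G}(N)$, where $N=N_1\oplus\cdots\oplus N_m$, meaning that no other bricks (of $\mathcal{G}(N)$) can be inserted into $N_1,\dots,N_m$ (at any position) preserving (i); (iii) $\mathcal{G}(N)=\mathcal{A}$. A torsion class is a full subcategory closed under isomorphisms, extensions and factors. $\mathcal{T}\lessdot\mathcal{T}'$ means $\mathcal{T}\subsetneq\mathcal{T}'$ are torsion classes with no torsion class strictly between them. A maximal green sequence in $\mathcal{A}$ is a finite sequence of torsion classes $\mathcal{T}_0\lessdot\cdots\lessdot\mathcal{T}_m$ with $\mathcal{T}_0=0$ and $\mathcal{T}_m=\mathcal{A}$. An object $M$ is a minimal extending object for a torsion class $\mathcal{T}$ if (i) every proper factor of $M$ is in $\mathcal{T}$; (ii) if $0\to M\to X\to T\to0$ is a non-split exact sequence with $T\in\mathcal{T}$, then $X\in\mathcal{T}$; (iii) $\mathrm{Hom}(\mathcal{T},M)=0$. *)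

(* Defs.v *)
From mathcomp Require Import all_boot all_algebra.
From mathcomp Require Import boolp classical_sets.

Set Implicit Arguments.
Unset Strict Implicit.
Unset Printing Implicit Defensive.

Import GRing.Theory.
Local Open Scope ring_scope.
Local Open Scope classical_set_scope.

(* Objects and morphisms live in [Type], so every category here is small
   relative to the ambient universe.  [compm g f] is "g after f". *)
Record preadditive := Preadditive {
  obj :> Type;
  hom : obj -> obj -> zmodType;
  idm : forall X, hom X X;
  compm : forall X Y Z, hom Y Z -> hom X Y -> hom X Z;
  compmA : forall X Y Z W (h : hom Z W) (g : hom Y Z) (f : hom X Y),
    compm h (compm g f) = compm (compm h g) f;
  compm1l : forall X Y (f : hom X Y), compm (idm Y) f = f;
  compm1r : forall X Y (f : hom X Y), compm f (idm X) = f;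
  compmDl : forall X Y Z (g g' : hom Y Z) (f : hom X Y),
    compm (g + g') f = compm g f + compm g' f;
  compmDr : forall X Y Z (g : hom Y Z) (f f' : hom X Y),
    compm g (f + f') = compm g f + compm g f' }.

Arguments hom {_} _ _.
Arguments idm {_} _.
Arguments compm {_ _ _ _} _ _.

Notation "g \oc f" := (compm g f) (at level 40, left associativity).

Section Preadditive.
Variable C : preadditive.
Implicit Types X Y Z W : C.

(* X is both initial and terminal: hom-groups always contain 0. *)
Definition is_zero X :=
  (forall Y (f : hom X Y), f = 0) /\ (forall Y (f : hom Y X), f = 0).

Definition monic X Y (f : hom X Y) :=
  forall W (u v : hom W X), f \oc u = f \oc v -> u = v.

Definition epic X Y (f : hom X Y) :=
  forall W (u v : hom Y W), u \oc f = v \oc f -> u = v.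

Definition iso X Y (f : hom X Y) :=
  exists g : hom Y X, g \oc f = idm X /\ f \oc g = idm Y.

Definition isomorphic X Y := exists f : hom X Y, iso f.

Definition is_kernel K X Y (k : hom K X) (f : hom X Y) :=
  f \oc k = 0 /\
  forall W (u : hom W X), f \oc u = 0 -> exists! v : hom W K, k \oc v = u.

Definition is_cokernel X Y Q (f : hom X Y) (q : hom Y Q) :=
  q \oc f = 0 /\
  forall W (u : hom Y W), u \oc f = 0 -> exists! v : hom Q W, v \oc q = u.

(* exactness of 0 -> X -f-> Y -g-> Z -> 0 *)
Definition short_exact X Y Z (f : hom X Y) (g : hom Y Z) :=
  is_kernel f g /\ is_cokernel f g.

Definition split_exact X Y Z (f : hom X Y) (g : hom Y Z) :=
  short_exact f g /\ exists s : hom Z Y, g \oc s = idm Z.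

End Preadditive.

Record abelian_category := AbelianCategory {
  precat :> preadditive;
  zob : precat;
  zobP : is_zero zob;
  biprod : precat -> precat -> precat;
  binj1 : forall X Y, hom X (biprod X Y);
  binj2 : forall X Y, hom Y (biprod X Y);
  bproj1 : forall X Y, hom (biprod X Y) X;
  bproj2 : forall X Y, hom (biprod X Y) Y;
  bproj1_binj1 : forall X Y, bproj1 X Y \oc binj1 X Y = idm X;
  bproj2_binj2 : forall X Y, bproj2 X Y \oc binj2 X Y = idm Y;
  bproj1_binj2 : forall X Y, bproj1 X Y \oc binj2 X Y = 0;
  bproj2_binj1 : forall X Y, bproj2 X Y \oc binj1 X Y = 0;
  biprod_id : forall X Y,
    binj1 X Y \oc bproj1 X Y + binj2 X Y \oc bproj2 X Y = idm (biprod X Y);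
  has_kernels : forall (X Y : precat) (f : hom X Y),
    exists (K : precat) (k : hom K X), is_kernel k f;
  has_cokernels : forall (X Y : precat) (f : hom X Y),
    exists (Q : precat) (q : hom Y Q), is_cokernel f q;
  monic_normal : forall (X Y : precat) (f : hom X Y),
    monic f -> exists (Z : precat) (g : hom Y Z), is_kernel f g;
  epic_normal : forall (X Y : precat) (f : hom X Y),
    epic f -> exists (Z : precat) (g : hom Z X), is_cokernel g f }.

Arguments zob {_}.
Arguments biprod {_} _ _.

(* A full subcategory of A is represented by its set of objects. *)
Section Abelian.
Variable A : abelian_category.
Implicit Types (X Y Z : A) (S T : set A) (Ns : seq A).

Definition simple_object X :=
  ~ is_zero X /\
  forall Y (f : hom Y X), monic f -> is_zero Y \/ iso f.

Definition indecomposable X :=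
  ~ is_zero X /\
  forall Y Z, isomorphic X (biprod Y Z) -> is_zero Y \/ is_zero Z.

(* The endomorphism ring is a division ring: 1 <> 0 and every nonzero element
   has a two-sided inverse. *)
Definition brick X :=
  idm X <> 0 /\ forall f : hom X X, f <> 0 -> iso f.

(* Objects with a finite filtration 0 = X_0 <= X_1 <= ... <= X_n = X whose
   subquotients X_k/X_(k-1) are isomorphic to members of S.  A cokernel is only
   determined up to isomorphism, so S need not be closed under isomorphism. *)
Inductive filtered S : set A :=
| filtered_zero X : is_zero X -> filtered S X
| filtered_ext X Y Z (f : hom X Y) (g : hom Y Z) :
    filtered S X -> short_exact f g -> S Z -> filtered S Y.

Definition finite_length X := filtered simple_object X.

Definition length_category := forall X, finite_length X.

Definition Filt S : set A := filtered (S `&` indecomposable).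

Definition hom_zero X Y := forall f : hom X Y, f = 0.

Definition perp_right X : set A := [set Y | hom_zero X Y].

Definition perp_left S : set A := [set X | forall Y, S Y -> hom_zero X Y].

Definition Gcal X : set A := perp_left (perp_right X).

Definition dsum Ns : A := foldr biprod zob Ns.

Definition hom_orthogonal Ns :=
  forall i j : nat, (i < j < size Ns)%N ->
    hom_zero (nth zob Ns i) (nth zob Ns j).

Definition complete_forward_hom_orthogonal Ns :=
  [/\ forall i : nat, (i < size Ns)%N -> brick (nth zob Ns i),
      hom_orthogonal Ns,
      forall (B : A) (k : nat), brick B -> Gcal (dsum Ns) B ->
        (forall i : nat, (i < size Ns)%N -> ~ isomorphic B (nth zob Ns i)) ->
        (k <= size Ns)%N -> ~ hom_orthogonal (take k Ns ++ B :: drop k Ns)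
    & Gcal (dsum Ns) = setT].

(* The first clause only excludes the empty set of objects. *)
Definition torsion_class T :=
  [/\ T zob,
      forall X Y, isomorphic X Y -> T X -> T Y,
      forall X Y Z (f : hom X Y) (g : hom Y Z),
        short_exact f g -> T X -> T Z -> T Y
    & forall X Y (f : hom X Y), epic f -> T X -> T Y].

Definition torsion_cover T T' :=
  [/\ torsion_class T, torsion_class T', T `<` T'
    & forall T'', torsion_class T'' -> ~ (T `<` T'' /\ T'' `<` T')].

(* Only the terms T_0, ..., T_m of the family are relevant. *)
Definition maximal_green_sequence (m : nat) (T_ : nat -> set A) :=
  [/\ forall i : nat, (i <= m)%N -> torsion_class (T_ i),
      T_ 0%N = [set X | is_zero X],
      T_ m = setT
    & forall i : nat, (i < m)%N -> torsion_cover (T_ i) (T_ i.+1)].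

Definition minimal_extending T (M : A) :=
  [/\ forall Q (q : hom M Q), epic q -> ~ iso q -> T Q,
      forall X Y (f : hom M X) (g : hom X Y),
        T Y -> short_exact f g -> ~ split_exact f g -> T X
    & forall Y, T Y -> hom_zero Y M].

(* For Ns = [:: N_1; ...; N_m]: N_i with the convention N_0 = 0, and
   G_i = G(N_0 (+) N_1 (+) ... (+) N_i). *)
Definition Nterm Ns (i : nat) : A := nth zob (zob :: Ns) i.

Definition Gterm Ns (i : nat) : set A := Gcal (dsum (take i.+1 (zob :: Ns))).

End Abelian.

(* Main.v *)
From mathcomp Require Import all_boot all_algebra.
From mathcomp Require Import boolp classical_sets.
Require Import Defs.

(** Each G_i is the torsion class of a torsion pair (G_i, F_i), where F_i is the
    right perpendicular of N_1, ..., N_i: finite length gives every object a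
    torsion part ([Gcal_torsion_pair]).  The passage from G_(i-1) to G_i is
    governed by the heart W of the interval, the objects that lie in both G_i
    and F_(i-1).  Forward hom-orthogonality puts N_i in W, and two properties
    of W carry the proof.

    - A nonzero X in W receives a nonzero map from N_i, since otherwise X would
      lie in both G_i and F_i.
    - A brick B in W maps nontrivially to N_i unless it is isomorphic to it:
      Hom(N_j, B) = 0 for j < i and Hom(B, N_k) = 0 for k > i hold
      automatically, so Hom(B, N_i) = 0 would allow B to be inserted just
      before N_i, against maximality ([Gterm_heart_brick]).

    The rest is a statement about an arbitrary interval of torsion pairs with a
    brick N having these two properties.  W is closed under images, so a
    nonzero object of W has a quotient in W that is a brick
    ([brick_quotient]): take images of non-invertible endomorphisms as long as
    possible.  Hence a nonzero map from N to an object of W is monic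
    ([N_to_W_monic]), every nonzero object of W maps onto N ([W_epic_N]), and
    the quotient of X in W by a copy of N is again in W
    ([W_monic_quotient]).  By induction on length every object of W is filtered
    by copies of N.

    Thus an object of G_i is an extension of an object filtered by copies of N_i
    by one of G_(i-1), which gives the filtrations.  A torsion class strictly
    above G_(i-1) and inside G_i contains a nonzero object of W, hence its
    factor N_i, hence all of G_i.  The minimal extending property
    compares a proper factor of N_i, or the middle term of a nonsplit extension,
    with its torsion-free quotient in W. *)

Set Implicit Arguments.
Unset Strict Implicit.
Unset Printing Implicit Defensive.

Import GRing.Theory.
Local Open Scope ring_scope.
Local Open Scope classical_set_scope.

(** * Kernels, cokernels and exact sequences *)

Section Chase.
Variable A : abelian_category.
Implicit Types X Y Z W K Q : A.

Lemma comp0m X Y Z (f : hom X Y) : (0 : hom Y Z) \oc f = 0.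
Proof. by apply: (addrI (0 \oc f)); rewrite -compmDl !addr0. Qed.

Lemma compm0 X Y Z (g : hom Y Z) : g \oc (0 : hom X Y) = 0.
Proof. by apply: (addrI (g \oc 0)); rewrite -compmDr !addr0. Qed.

Lemma compNm X Y Z (g : hom Y Z) (f : hom X Y) : (- g) \oc f = - (g \oc f).
Proof. by apply: (addrI (g \oc f)); rewrite -compmDl !subrr comp0m. Qed.

Lemma compmN X Y Z (g : hom Y Z) (f : hom X Y) : g \oc (- f) = - (g \oc f).
Proof. by apply: (addrI (g \oc f)); rewrite -compmDr !subrr compm0. Qed.

Lemma is_zeroP X : is_zero X <-> idm X = 0.
Proof.
split=> [[h _]|h]; first exact: h.
by split=> Y f; [rewrite -(compm1r f) | rewrite -(compm1l f)];
  rewrite h ?compm0 ?comp0m.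
Qed.

Lemma monicP X Y (f : hom X Y) :
  monic f <-> forall W (u : hom W X), f \oc u = 0 -> u = 0.
Proof.
split=> [mf W u fu|h W u v fuv]; first by apply: mf; rewrite fu compm0.
by apply/subr0_eq/h; rewrite compmDr compmN fuv subrr.
Qed.

Lemma epicP X Y (f : hom X Y) :
  epic f <-> forall W (u : hom Y W), u \oc f = 0 -> u = 0.
Proof.
split=> [ef W u uf|h W u v ufv]; first by apply: ef; rewrite uf comp0m.
by apply/subr0_eq/h; rewrite compmDl compNm ufv subrr.
Qed.

Lemma kernel_monic K X Y (k : hom K X) (f : hom X Y) : is_kernel k f -> monic k.
Proof.
case=> fk h W u v kuv.
have [|w [_ uniq]] := h W (k \oc u); first by rewrite compmA fk comp0m.
by rewrite -(uniq u erefl) (uniq v).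
Qed.

Lemma cokernel_epic X Y Q (f : hom X Y) (q : hom Y Q) : is_cokernel f q -> epic q.
Proof.
case=> qf h W u v uqv.
have [|w [_ uniq]] := h W (u \oc q); first by rewrite -compmA qf compm0.
by rewrite -(uniq u erefl) (uniq v).
Qed.

Lemma kernel_lift K X Y W (k : hom K X) (f : hom X Y) (u : hom W X) :
  is_kernel k f -> f \oc u = 0 -> exists v, u = k \oc v.
Proof. by case=> _ h /h[v [<- _]]; exists v. Qed.

Lemma cokernel_lift X Y Q W (f : hom X Y) (q : hom Y Q) (u : hom Y W) :
  is_cokernel f q -> u \oc f = 0 -> exists v, u = v \oc q.
Proof. by case=> _ h /h[v [<- _]]; exists v. Qed.

Lemma monic_kernelP K X Y (k : hom K X) (f : hom X Y) :
  monic k -> f \oc k = 0 ->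
  (forall W (u : hom W X), f \oc u = 0 -> exists v, u = k \oc v) -> is_kernel k f.
Proof.
move=> mk fk h; split=> // W u /h[v ->].
by exists v; split=> // w /mk.
Qed.

Lemma epic_cokernelP X Y Q (f : hom X Y) (q : hom Y Q) :
  epic q -> q \oc f = 0 ->
  (forall W (u : hom Y W), u \oc f = 0 -> exists v, u = v \oc q) -> is_cokernel f q.
Proof.
move=> eq qf h; split=> // W u /h[v ->].
by exists v; split=> // w /eq.
Qed.

(** An epic is the cokernel of some g; as g factors through the kernel k, whatever
    kills k kills g. *)
Lemma epic_kernel_exact K X Y (k : hom K X) (f : hom X Y) :
  epic f -> is_kernel k f -> short_exact k f.
Proof.
move=> ef kf; split=> //; have [Z [g gf]] := epic_normal ef.
apply: epic_cokernelP => //; first exact: kf.1.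
move=> W u uk; apply: (cokernel_lift gf).
by have [v ->] := kernel_lift kf gf.1; rewrite compmA uk comp0m.
Qed.

Lemma monic_cokernel_exact X Y Q (f : hom X Y) (q : hom Y Q) :
  monic f -> is_cokernel f q -> short_exact f q.
Proof.
move=> mf fq; split=> //; have [Z [g fg]] := monic_normal mf.
apply: monic_kernelP => //; first exact: fq.1.
move=> W u qu; apply: (kernel_lift fg).
by have [v ->] := cokernel_lift fq fg.1; rewrite -compmA qu compm0.
Qed.

Lemma epic_exact X Y (f : hom X Y) :
  epic f -> exists K (k : hom K X), short_exact k f.
Proof.
move=> ef; have [K [k kf]] := has_kernels f.
by exists K, k; apply: epic_kernel_exact.
Qed.

Lemma monic_exact X Y (f : hom X Y) :
  monic f -> exists Q (q : hom Y Q), short_exact f q.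
Proof.
move=> mf; have [Q [q fq]] := has_cokernels f.
by exists Q, q; apply: monic_cokernel_exact.
Qed.

Lemma exact_monic X Y Z (f : hom X Y) (g : hom Y Z) : short_exact f g -> monic f.
Proof. by case=> /kernel_monic. Qed.

Lemma exact_epic X Y Z (f : hom X Y) (g : hom Y Z) : short_exact f g -> epic g.
Proof. by case=> _ /cokernel_epic. Qed.

Lemma monic_comp X Y Z (g : hom Y Z) (f : hom X Y) :
  monic g -> monic f -> monic (g \oc f).
Proof. by move=> mg mf W u v; rewrite -!compmA => /mg/mf. Qed.

Lemma epic_comp X Y Z (g : hom Y Z) (f : hom X Y) :
  epic g -> epic f -> epic (g \oc f).
Proof. by move=> eg ef W u v; rewrite !compmA => /ef/eg. Qed.

Lemma monic_compr X Y Z (g : hom Y Z) (f : hom X Y) : monic (g \oc f) -> monic f.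
Proof. by move=> mgf W u v fuv; apply: mgf; rewrite -!compmA fuv. Qed.

Lemma epic_compl X Y Z (g : hom Y Z) (f : hom X Y) : epic (g \oc f) -> epic g.
Proof. by move=> egf W u v ugv; apply: egf; rewrite !compmA ugv. Qed.

Lemma iso_monic X Y (f : hom X Y) : iso f -> monic f.
Proof.
by case=> g [gf _]; apply: (@monic_compr _ _ _ g); rewrite gf => W u v; rewrite !compm1l.
Qed.

Lemma iso_epic X Y (f : hom X Y) : iso f -> epic f.
Proof.
by case=> g [_ fg]; apply: (@epic_compl _ _ _ _ g); rewrite fg => W u v; rewrite !compm1r.
Qed.

Lemma monic_epic_iso X Y (f : hom X Y) : monic f -> epic f -> iso f.
Proof.
move=> mf ef; have [Z [g fg]] := monic_normal mf.
have g0 : g = 0 by apply: (iffLR (epicP _) ef); exact: fg.1.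
have [|v fv] := kernel_lift (u := idm Y) fg; first by rewrite g0 comp0m.
exists v; split=> //; apply: mf.
by rewrite compmA -fv compm1l compm1r.
Qed.

Lemma iso_idm X : iso (idm X).
Proof. by exists (idm X); rewrite compm1l. Qed.

Lemma iso_comp X Y Z (g : hom Y Z) (f : hom X Y) : iso g -> iso f -> iso (g \oc f).
Proof.
move=> ig jf; apply: monic_epic_iso.
  by apply: monic_comp; apply: iso_monic.
by apply: epic_comp; apply: iso_epic.
Qed.

Lemma isomorphic_sym X Y : isomorphic X Y -> isomorphic Y X.
Proof. by case=> f [g [gf fg]]; exists g, f. Qed.

Lemma monic_is_zero X Y (f : hom X Y) : monic f -> is_zero Y -> is_zero X.
Proof.
by move=> mf [_ zY]; apply/is_zeroP; apply: mf; rewrite (zY _ (f \oc _)) compm0.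
Qed.

Lemma epic_is_zero X Y (f : hom X Y) : epic f -> is_zero X -> is_zero Y.
Proof.
by move=> ef [zX _]; apply/is_zeroP; apply: ef; rewrite (zX _ (_ \oc f)) comp0m.
Qed.

Lemma zero_kernel_monic K X Y (k : hom K X) (f : hom X Y) :
  is_kernel k f -> is_zero K -> monic f.
Proof.
move=> kf [_ zK]; apply/monicP => W u fu.
by have [v ->] := kernel_lift kf fu; rewrite (zK _ v) compm0.
Qed.

Lemma zero_cokernel_epic X Y Q (f : hom X Y) (q : hom Y Q) :
  is_cokernel f q -> is_zero Q -> epic f.
Proof.
move=> fq [zQ _]; apply/epicP => W u uf.
by have [v ->] := cokernel_lift fq uf; rewrite (zQ _ v) comp0m.
Qed.

Lemma exact_iso_mid X Y Y' Z (f : hom X Y) (g : hom Y Z) (h : hom Y Y') (h' : hom Y' Y) :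
  h' \oc h = idm Y -> h \oc h' = idm Y' ->
  short_exact f g -> short_exact (h \oc f) (g \oc h').
Proof.
move=> h'h hh' fg; have ih : iso h by exists h'.
have ih' : iso h' by exists h.
apply: epic_kernel_exact; first by apply: epic_comp; [exact: exact_epic fg|exact: iso_epic].
case: (fg) => kf _; apply: monic_kernelP.
- by apply: monic_comp; [exact: iso_monic|exact: exact_monic fg].
- by rewrite compmA -(compmA g) h'h compm1r kf.1.
move=> W u; rewrite -compmA => /(kernel_lift kf)[v e]; exists v.
by rewrite -compmA -e compmA hh' compm1l.
Qed.

(** The monic part is the kernel of the cokernel of f. *)
Lemma image_factorization X Y (f : hom X Y) :
  exists I (e : hom X I) (m : hom I Y), [/\ epic e, monic m & f = m \oc e].
Proof.
have [C [c fc]] := has_cokernels f; have [I [m mc]] := has_kernels c.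
have [e fe] := kernel_lift mc fc.1; have mm := kernel_monic mc.
exists I, e, m; split=> //; apply/epicP => W u ue.
(* The kernel j of u composes with m to a smaller subobject through which f
   still factors; it is again a kernel, so m factors through it and j splits. *)
have [J [j ju]] := has_kernels u; have [e' ee'] := kernel_lift ju ue.
have [Z [h jh]] := monic_normal (monic_comp mm (kernel_monic ju)).
have [|h' hh'] := cokernel_lift (u := h) fc.
  by rewrite fe ee' (compmA m) compmA jh.1 comp0m.
have [|v mv] := kernel_lift (u := m) jh; first by rewrite hh' -compmA mc.1 compm0.
have jv : j \oc v = idm I by apply: mm; rewrite compmA -mv compm1r.
by rewrite -(compm1r u) -jv compmA ju.1 comp0m.
Qed.

(** The preimage P of a subobject L under an epic q is an extension of L by the
    kernel of q.  Filtrations and torsion classes are transported along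
    quotients by this lemma. *)
Lemma kernel_comp_exact X Y Z K L P (k : hom K X) (q : hom X Y)
    (l : hom L Y) (p : hom Y Z) (i : hom P X) :
  short_exact k q -> short_exact l p -> short_exact i (p \oc q) ->
  exists (a : hom K P) (b : hom P L), short_exact a b /\ i \oc a = k.
Proof.
move=> kq lp ipq.
have [|a ka] := kernel_lift (u := k) ipq.1; first by rewrite -compmA kq.1.1 compm0.
have [|b ib] := kernel_lift (u := q \oc i) lp.1; first by rewrite compmA ipq.1.1.
have ml := exact_monic lp; have mi := exact_monic ipq; have eq := exact_epic kq.
exists a, b; split=> //; apply: epic_kernel_exact.
  apply/epicP => W u ub.
  have [J [j ju]] := has_kernels u; have [b' bb'] := kernel_lift ju ub.
  (* If b had image inside J, then Z would also be the cokernel of the smaller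
     subobject J of Y, which forces J = L. *)
  have mlj := monic_comp ml (kernel_monic ju).
  have [C [c ljc]] := monic_exact mlj.
  have [|d cd] := cokernel_lift (u := c \oc q) ipq.2.
    by rewrite -compmA ib bb' (compmA l) compmA ljc.1.1 comp0m.
  have cp : c = d \oc p by apply: eq; rewrite cd compmA.
  have [|v lv] := kernel_lift (u := l) ljc.1; first by rewrite cp -compmA lp.1.1 compm0.
  have jv : j \oc v = idm L by apply: ml; rewrite compmA -lv compm1r.
  by rewrite -(compm1r u) -jv compmA ju.1 comp0m.
apply: monic_kernelP.
- by apply: (@monic_compr _ _ _ i); rewrite -ka; apply: exact_monic kq.
- by apply: ml; rewrite compmA -ib -compmA -ka kq.1.1 compm0.
move=> W u bu.
have [|v iv] := kernel_lift (u := i \oc u) kq.1.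
  by rewrite compmA ib -compmA bu compm0.
by exists v; apply: mi; rewrite iv ka compmA.
Qed.

(** The endomorphism 1 - f (r f)^-1 r of Y kills f, so it factors through g;
    the factor is the section. *)
Lemma retraction_section X Y Z (f : hom X Y) (g : hom Y Z) (r : hom Y X) :
  short_exact f g -> iso (r \oc f) -> exists s, g \oc s = idm Z.
Proof.
move=> fg [h [hrf _]].
have [|s es] := cokernel_lift (u := idm Y - (f \oc h) \oc r) fg.2.
  by rewrite compmDl compNm compm1l -!compmA hrf compm1r subrr.
exists s; apply: (exact_epic fg).
by rewrite -compmA -es compmDr compmN !compmA fg.1.1 !comp0m subr0 compm1r compm1l.
Qed.

Lemma zero_monic X Y (f : hom X Y) : is_zero X -> monic f.
Proof. by case=> _ zX W u v _; rewrite (zX _ u) (zX _ v). Qed.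

Lemma zero_epic X Y (f : hom X Y) : is_zero Y -> epic f.
Proof. by case=> zY _ W u v _; rewrite (zY _ u) (zY _ v). Qed.

Lemma exact_zero_l X : short_exact (0 : hom zob X) (idm X).
Proof.
apply: epic_kernel_exact; first exact: iso_epic (iso_idm X).
apply: monic_kernelP; [exact/zero_monic/zobP|by rewrite compm0|].
by move=> W u; rewrite compm1l => ->; exists 0; rewrite comp0m.
Qed.

(** * Length *)

Inductive composition_length : nat -> A -> Prop :=
| composition_zero X : is_zero X -> composition_length 0 X
| composition_simple n X Y Z (f : hom X Y) (g : hom Y Z) :
    composition_length n X -> short_exact f g -> simple_object Z ->
    composition_length n.+1 Y.

(** Peel off the simple top factor S of Y.  If Y -> S kills X, it is a factor of Z;
    otherwise X -> S is onto, S is a factor of X, and the kernels of X -> S and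
    Y -> S have the same quotient Z. *)
Lemma composition_length_exact n Y : composition_length n Y ->
  forall X Z (f : hom X Y) (g : hom Y Z), short_exact f g ->
  exists a b, [/\ composition_length a X, composition_length b Z & (a + b <= n)%N].
Proof.
elim=> [{}Y zY X Z f g fg|{n}{}n Y' {}Y S y s _ IH ys simS X Z f g fg].
  exists 0%N, 0%N; split=> //; apply: composition_zero.
    exact: monic_is_zero (exact_monic fg) zY.
  exact: epic_is_zero (exact_epic fg) zY.
have es := exact_epic ys; have eg := exact_epic fg.
have [sf0|sf0] := EM (s \oc f = 0).
  have [t st] := cokernel_lift fg.2 sf0; subst s.
  have [L [l lt]] := epic_exact (epic_compl es).
  have [a [b [ab _]]] := kernel_comp_exact fg lt ys.
  have [m [n' [hm hn le]]] := IH _ _ _ _ ab.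
  exists m, n'.+1; split=> //; last by rewrite addnS ltnS.
  exact: composition_simple hn lt simS.
have esf : epic (s \oc f).
  have [I [e [m [ee mm sfE]]]] := image_factorization (s \oc f).
  rewrite sfE; apply: epic_comp => //.
  have [[_ zI]|] := simS.2 _ _ mm; last exact: iso_epic.
  by case: sf0; rewrite sfE (zI _ e) compm0.
have [K [k ksf]] := epic_exact esf.
have [|j yj] := kernel_lift (u := f \oc k) ys.1; first by rewrite compmA ksf.1.1.
have jexact : short_exact j (g \oc y).
  apply: epic_kernel_exact.
    apply/epicP => W u; rewrite compmA => /(cokernel_lift ys.2)[v ugv].
    apply: (iffLR (epicP _) eg).
    rewrite ugv (iffLR (epicP _) esf _ v) ?comp0m //.
    by rewrite compmA -ugv -compmA fg.1.1 compm0.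
  apply: monic_kernelP.
  - apply: (@monic_compr _ _ _ y); rewrite -yj.
    by apply: monic_comp; [exact: exact_monic fg|exact: exact_monic ksf].
  - by rewrite -compmA -yj compmA fg.1.1 comp0m.
  move=> W u; rewrite -compmA => /(kernel_lift fg.1)[v yuv].
  have [|w vw] := kernel_lift (u := v) ksf.1.
    by rewrite -compmA -yuv compmA ys.1.1 comp0m.
  exists w; apply: (exact_monic ys).
  by rewrite yuv vw !compmA yj.
have [m [n' [hm hn le]]] := IH _ _ _ _ jexact.
exists m.+1, n'; split=> //; exact: composition_simple hm ksf simS.
Qed.

(** This half of the additivity of length already makes it drop strictly along
    proper subobjects and proper quotients. *)
Definition superadditive_length (ell : A -> nat) :=
  (forall X Y Z (f : hom X Y) (g : hom Y Z),
     short_exact f g -> (ell X + ell Z <= ell Y)%N) /\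
  (forall X, ell X = 0%N -> is_zero X).

Lemma superadditive_length_exists :
  length_category A -> exists ell, superadditive_length ell.
Proof.
move=> lenA.
have [ell ellP] : exists ell : A -> nat, forall X, composition_length (ell X) X /\
    forall n, composition_length n X -> (ell X <= n)%N.
  suff /choice[ell ellP] : forall X, exists m, composition_length m X /\
    forall n, composition_length n X -> (m <= n)%N by exists ell.
  move=> X.
  have ex : exists n, `[< composition_length n X >].
    elim: (lenA X) => [Y zY|X' Y Z f g _ [n /asboolP IH] fg simZ].
      by exists 0%N; apply/asboolP/composition_zero.
    by exists n.+1; apply/asboolP; apply: composition_simple IH fg simZ.
  exists (ex_minn ex); case: ex_minnP => m /asboolP mX minm; split=> // n nX.
  exact/minm/asboolP.
exists ell; split=> [X Y Z f g fg|X ellX].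
  have [a [b [aX bZ le]]] := composition_length_exact (ellP Y).1 fg.
  by apply: leq_trans le; apply: leq_add; apply: (ellP _).2.
have := (ellP X).1; rewrite ellX; move: {-1}0%N (erefl 0%N) => z.
by move=> + H; case: H.
Qed.

Lemma length_monic ell X Y (f : hom X Y) :
  superadditive_length ell -> monic f -> (ell X < ell Y)%N \/ iso f.
Proof.
move=> [add len0] mf; have [Q [q fq]] := monic_exact mf.
have le := add _ _ _ _ _ fq; have [ellQ|Q_gt0] := posnP (ell Q).
  right; apply: monic_epic_iso => //.
  exact: zero_cokernel_epic fq.2 (len0 _ ellQ).
by left; apply: leq_trans le; rewrite -addn1 leq_add2l.
Qed.

Lemma length_epic ell X Y (f : hom X Y) :
  superadditive_length ell -> epic f -> (ell Y < ell X)%N \/ iso f.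
Proof.
move=> [add len0] ef; have [K [k kf]] := epic_exact ef.
have le := add _ _ _ _ _ kf; have [ellK|K_gt0] := posnP (ell K).
  right; apply: monic_epic_iso => //.
  exact: zero_kernel_monic kf.1 (len0 _ ellK).
by left; apply: leq_trans le; rewrite -add1n leq_add2r.
Qed.

(** * Filtrations *)

Section Filtered.
Variable S : set A.

Lemma filtered_isomorphic X Y : isomorphic X Y -> filtered S X -> filtered S Y.
Proof.
move=> XY SX; case: SX XY => [{}X zX|U {}X Z f g SU fg SZ] [h ih].
  by apply/filtered_zero/(epic_is_zero (iso_epic ih)).
have [h' [h'h hh']] := ih.
exact: filtered_ext SU (exact_iso_mid h'h hh' fg) SZ.
Qed.

(** Pull the filtration of Z back to Y. *)
Lemma filtered_extension Z : filtered S Z ->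
  forall X Y (f : hom X Y) (g : hom Y Z),
    short_exact f g -> filtered S X -> filtered S Y.
Proof.
elim=> [{}Z zZ X Y f g fg|Z' {}Z W z w _ IH zw SW X Y f g fg SX].
  apply: filtered_isomorphic; exists f; apply: monic_epic_iso.
    exact: exact_monic fg.
  exact: zero_cokernel_epic fg.2 zZ.
have [P [p pwg]] := epic_exact (epic_comp (exact_epic zw) (exact_epic fg)).
have [a [b [ab _]]] := kernel_comp_exact fg zw pwg.
exact: filtered_ext (IH _ _ _ _ ab SX) pwg SW.
Qed.

Lemma filtered1 X : S X -> filtered S X.
Proof. exact: filtered_ext (filtered_zero _ (@zobP A)) (exact_zero_l X). Qed.

Lemma filtered_torsion (T : set A) X :
  torsion_class T -> (forall Y, S Y -> T Y) -> filtered S X -> T X.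
Proof.
move=> [T0 _ Text Tfac] ST; elim=> [Y zY|X' Y Z f g _ TX fg /ST TZ].
  by apply: Tfac T0; apply: (zero_epic (f := 0)).
exact: Text fg TX TZ.
Qed.

End Filtered.

Lemma filtered_sub (S T : set A) X :
  (forall Y, S Y -> filtered T Y) -> filtered S X -> filtered T X.
Proof.
move=> ST; elim=> [Y|X' Y Z f g _ TX fg /ST TZ]; first exact: filtered_zero.
exact: (filtered_extension TZ fg TX).
Qed.

(** The idempotent projecting X onto Y is zero or invertible. *)
Lemma brick_indecomposable X : brick X -> indecomposable X.
Proof.
case=> id_neq0 divX; split=> [/is_zeroP //|Y Z [f [g [gf fg]]]].
pose e := g \oc (binj1 Y Z \oc bproj1 Y Z) \oc f.
have fe : f \oc e \oc g = binj1 Y Z \oc bproj1 Y Z.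
  by rewrite /e !compmA fg compm1l -compmA fg compm1r.
have [e0|/divX ie] := EM (e = 0); [left|right]; apply/is_zeroP.
  have : bproj1 Y Z \oc (f \oc e \oc g) \oc binj1 Y Z = idm Y.
    by rewrite fe compmA bproj1_binj1 compm1l bproj1_binj1.
  by rewrite e0 compm0 comp0m compm0 comp0m.
have ig : iso g by exists f.
have jf : iso f by exists g.
have/iso_epic ep : iso (binj1 Y Z \oc bproj1 Y Z).
  by rewrite -fe; apply: iso_comp ig; apply: iso_comp.
have p2 : bproj2 Y Z = 0.
  by apply: (iffLR (epicP _) ep); rewrite compmA bproj2_binj1 comp0m.
by rewrite -(bproj2_binj2 Y Z) p2 comp0m.
Qed.

(** * Torsion pairs *)

Definition torsion_pair (T F : set A) :=
  [/\ forall X, T X <-> forall Y, F Y -> hom_zero X Y,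
      forall Y, F Y <-> forall X, T X -> hom_zero X Y
    & forall X, exists U V (u : hom U X) (v : hom X V),
        [/\ short_exact u v, T U & F V]].

Section TorsionPair.
Variables T F : set A.
Hypothesis TF : torsion_pair T F.

Lemma torsion_hom_zero X Y : T X -> F Y -> hom_zero X Y.
Proof. by case: TF => TP _ _ /TP; apply. Qed.

Lemma torsion_epic X Y (f : hom X Y) : epic f -> T X -> T Y.
Proof.
case: TF => TP _ _ ef TX; apply/TP => Z FZ g.
by apply: (iffLR (epicP _) ef); apply: torsion_hom_zero.
Qed.

Lemma torsionfree_monic X Y (f : hom X Y) : monic f -> F Y -> F X.
Proof.
case: TF => _ FP _ mf FY; apply/FP => Z TZ g.
by apply: (iffLR (monicP _) mf); apply: torsion_hom_zero.
Qed.

Lemma torsion_extension X Y Z (f : hom X Y) (g : hom Y Z) :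
  short_exact f g -> T X -> T Z -> T Y.
Proof.
case: TF => TP _ _ fg TX TZ; apply/TP => W FW h.
have [|h' ->] := cokernel_lift (u := h) fg.2; first exact: torsion_hom_zero.
by rewrite (torsion_hom_zero TZ FW h') comp0m.
Qed.

Lemma torsion_zero X : is_zero X -> T X.
Proof. by case: TF => TP _ _ [zX _]; apply/TP => Y _; apply: zX. Qed.

Lemma torsion_pair_class : torsion_class T.
Proof.
split; first exact/torsion_zero/zobP.
- by move=> X Y [f jf]; apply: torsion_epic (iso_epic jf).
- by move=> X Y Z f g; apply: torsion_extension.
- by move=> X Y f; apply: torsion_epic.
Qed.

Lemma torsion_torsionfree_zero X : T X -> F X -> is_zero X.
Proof. by move=> TX FX; apply/is_zeroP/torsion_hom_zero. Qed.

End TorsionPair.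

(** The torsion part of X is reached by a descent on quotients q : X -> Y with
    kernel in G(N): a nonzero map N -> Y has its image I in G(N), and the kernel
    of X -> Y/I is an extension of I by the kernel of q. *)
Lemma Gcal_torsion_pair (N : A) :
  length_category A -> torsion_pair (Gcal N) (perp_right N).
Proof.
move=> lenA; have [ell ellP] := superadditive_length_exists lenA.
have TN : Gcal N N by [].
have Tepic X Y (f : hom X Y) : epic f -> Gcal N X -> Gcal N Y.
  move=> ef TX Z FZ g; apply: (iffLR (epicP _) ef); exact: TX.
split=> // [Y|X]; first by split=> [FY X TX|]; [exact: TX|apply].
suff /(_ X (idm X) zob 0 (exact_zero_l X)) : forall Y (q : hom X Y) K (k : hom K X),
    short_exact k q -> Gcal N K ->
    exists U V (u : hom U X) (v : hom X V),
      [/\ short_exact u v, Gcal N U & perp_right N V].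
  by apply=> Y _; apply: (zobP A).1.
move=> Y; move: {2}(ell Y).+1 (ltnSn (ell Y)) => n.
elim: n Y => // n IH Y; rewrite ltnS => leYn q K k kq TK.
have [FY|/existsNP[f /eqP f0]] := EM (perp_right N Y); first by exists K, Y, k, q.
have [I [e [m [ee mm fE]]]] := image_factorization f.
have [C [p mp]] := monic_exact mm; have ep := exact_epic mp.
have [P [i ipq]] := epic_exact (epic_comp ep (exact_epic kq)).
have [a [b [ab _]]] := kernel_comp_exact kq mp ipq.
have [ltCY|/iso_monic mp'] := length_epic ellP ep; last first.
  case/eqP: f0; rewrite fE (iffLR (monicP _) mp' _ m) ?comp0m //; exact: mp.1.1.
apply: IH ipq _; first exact: leq_trans ltCY leYn.
move=> W FW h; have [|h' ->] := cokernel_lift (u := h) ab.2; first exact: TK.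
by rewrite (Tepic _ _ _ ee TN _ FW h') comp0m.
Qed.

(** * An interval of torsion classes whose heart is governed by one brick *)

Section BrickInterval.
Variables (ell : A -> nat) (U FU T FT : set A) (N : A).
Hypotheses (ellP : superadditive_length ell).
Hypotheses (UP : torsion_pair U FU) (TP : torsion_pair T FT) (UT : U `<=` T).
Let W := T `&` FU.
Hypotheses (bN : brick N) (WN : W N).
Hypothesis hom_from_N : forall X, W X -> hom_zero N X -> is_zero X.
Hypothesis hom_to_N : forall B, brick B -> W B -> hom_zero B N -> isomorphic B N.

(** The image of a nonzero non-invertible endomorphism of X is a shorter nonzero
    object, a quotient of X that is again in W. *)
Lemma brick_quotient X : W X -> ~ is_zero X ->
  exists B (q : hom X B), [/\ brick B, W B & epic q].
Proof.
move: {2}(ell X).+1 (ltnSn (ell X)) => n.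
elim: n X => // n IH X; rewrite ltnS => leXn WX nzX.
have [bX|] := EM (brick X).
  by exists X, (idm X); split=> //; apply: iso_epic (iso_idm X).
move=> /not_andP[/contrapT/is_zeroP //|/existsNP[f /not_implyP[f0 nisof]]].
have [I [e [m [ee mm fE]]]] := image_factorization f.
have WI : W I.
  by split; [apply: (torsion_epic TP) ee WX.1|apply: (torsionfree_monic UP) mm WX.2].
have nzI : ~ is_zero I.
  by move=> [zI _]; apply: f0; rewrite fE (zI _ m) comp0m.
have ltIX : (ell I < ell X)%N.
  have [//|im] := length_monic ellP mm; have [//|ie] := length_epic ellP ee.
  by case: nisof; rewrite fE; apply: iso_comp.
have [B [q [bB WB eq]]] := IH I (leq_trans ltIX leXn) WI nzI.
by exists B, (q \oc e); split=> //; apply: epic_comp.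
Qed.

(** A brick quotient B of the image of f has a nonzero map back to N, and the
    composite N -> B -> N is nonzero, hence invertible. *)
Lemma N_to_W_monic X (f : hom N X) : W X -> f <> 0 -> monic f.
Proof.
move=> WX f0; have [I [e [m [ee mm fE]]]] := image_factorization f.
have WI : W I.
  by split; [apply: (torsion_epic TP) ee WN.1|apply: (torsionfree_monic UP) mm WX.2].
have nzI : ~ is_zero I.
  by move=> [zI _]; apply: f0; rewrite fE (zI _ m) comp0m.
have [B [q [bB WB eq]]] := brick_quotient WI nzI.
have eqe := epic_comp eq ee.
have [g g0] : exists g : hom B N, g <> 0.
  apply: contrapT => /forallNP nog.
  have zBN : hom_zero B N by move=> g; apply: contrapT (nog g).
  have [g ig] := hom_to_N bB WB zBN; apply: bN.1; apply: (iffLR (epicP _) (iso_epic ig)).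
  by rewrite compm1l; apply: zBN.
have/bN.2/iso_monic : g \oc (q \oc e) <> 0.
  by move=> /(iffLR (epicP _) eqe).
move=> /monic_compr/monic_compr me.
by rewrite fE; apply: monic_comp.
Qed.

(** N and a brick quotient B of X map nontrivially to each other; N -> B is monic,
    so B -> N -> B is nonzero, hence invertible, and B is a copy of N. *)
Lemma W_epic_N X : W X -> ~ is_zero X -> exists q : hom X N, epic q.
Proof.
move=> WX nzX; have [B [q [bB WB eq]]] := brick_quotient WX nzX.
suff [g ig] : isomorphic B N.
  by exists (g \oc q); apply: epic_comp => //; apply: iso_epic.
have [zBN|/existsNP[g g0]] := EM (hom_zero B N); first exact: hom_to_N.
have [zNB|/existsNP[f f0]] := EM (hom_zero N B).
  by case: bB => idB _; have /is_zeroP := hom_from_N WB zNB.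
have mf := N_to_W_monic WB f0; apply: isomorphic_sym; exists f.
apply: monic_epic_iso => //; apply: (@epic_compl _ _ _ _ g); apply: iso_epic.
by apply: bB.2 => /(iffLR (monicP _) mf).
Qed.

(** Let Y be the torsion-free quotient of C = X/N and P the kernel of X -> Y, an
    extension of the torsion part V of C by N.  Then P is in W and maps onto N;
    this map is invertible on N because Hom(V, N) = 0, so V embeds in P, and
    Hom(V, P) = 0 makes V zero. *)
Lemma W_monic_quotient X : W X -> ~ is_zero X ->
  exists Y (n : hom N X) (y : hom X Y), short_exact n y /\ W Y.
Proof.
move=> WX nzX.
have [n n0] : exists n : hom N X, n <> 0.
  by apply/existsNP => zNX; apply: nzX; apply: hom_from_N.
have mn := N_to_W_monic WX n0; have [C [c nc]] := monic_exact mn.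
have [_ _ /(_ C)[V [Y [v [y [vy UV FY]]]]]] := UP.
have TY : T Y.
  apply: (torsion_epic TP) WX.1; exact: epic_comp (exact_epic vy) (exact_epic nc).
have [P [i iyc]] := epic_exact (epic_comp (exact_epic vy) (exact_epic nc)).
have [a [b [ab ia]]] := kernel_comp_exact nc vy iyc.
have WP : W P.
  split; first by apply: (torsion_extension TP) ab WN.1 _; apply: UT.
  exact: (torsionfree_monic UP) (exact_monic iyc) WX.2.
have nzP : ~ is_zero P.
  by move=> /(monic_is_zero (exact_monic ab))/is_zeroP; apply: bN.1.
have [g eg] := W_epic_N WP nzP.
have ga0 : g \oc a <> 0.
  move=> /(cokernel_lift ab.2)[h gE]; apply: bN.1; apply: (iffLR (epicP _) eg).
  by rewrite compm1l gE (torsion_hom_zero UP UV WN.2 h) comp0m.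
have [s bs] := retraction_section ab (bN.2 _ ga0).
have zV : is_zero V.
  by apply/is_zeroP; rewrite -bs (torsion_hom_zero UP UV WP.2 s) compm0.
exists Y, n, (y \oc c); split=> //.
apply: monic_cokernel_exact => //.
have my := zero_kernel_monic vy.1 zV.
apply: epic_cokernelP; first exact: epic_comp (exact_epic vy) (exact_epic nc).
  by rewrite -compmA nc.1.1 compm0.
move=> Z h /(cokernel_lift nc.2)[h' ->].
have [y' [y'y _]] := monic_epic_iso my (exact_epic vy).
by exists (h' \oc y'); rewrite -!compmA (compmA y') y'y compm1l.
Qed.

Lemma W_filtered X : W X -> filtered [set N] X.
Proof.
move: {2}(ell X).+1 (ltnSn (ell X)) => n.
elim: n X => // n IH X; rewrite ltnS => leXn WX.
have [zX|nzX] := EM (is_zero X); first exact: filtered_zero.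
have [Y [f [g [fg WY]]]] := W_monic_quotient WX nzX.
have [ltYX|/iso_monic mg] := length_epic ellP (exact_epic fg); last first.
  case: bN.1; apply: (exact_monic fg); rewrite compm0 compm1r.
  by apply: (iffLR (monicP _) mg); apply: fg.1.1.
apply: (filtered_extension _ fg); last exact: filtered1.
by apply: IH WY; apply: leq_trans ltYX leXn.
Qed.

Lemma torsion_quotient_W X :
  T X -> exists V Y (v : hom V X) (y : hom X Y), [/\ short_exact v y, U V & W Y].
Proof.
move=> TX; have [_ _ /(_ X)[V [Y [v [y [vy UV FY]]]]]] := UP.
exists V, Y, v, y; split=> //; split=> //.
exact: (torsion_epic TP) (exact_epic vy) TX.
Qed.

Lemma interval_filtered (S : set A) X :
  (forall Y, U Y -> filtered S Y) -> S N -> T X -> filtered S X.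
Proof.
move=> US SN /torsion_quotient_W[V [Y [v [y [vy UV WY]]]]].
apply: (filtered_extension _ vy (US _ UV)).
by apply: filtered_sub (W_filtered WY) => _ ->; apply: filtered1.
Qed.

(** If the torsion-free quotient Y of a factor Q of N is nonzero, then N -> Y is
    monic and Q is not proper.  If the torsion-free quotient Z of an extension X
    of Y in U by N is nonzero, then X -> Z -> N does not vanish on N, so the
    extension splits. *)
Lemma interval_minimal_extending : minimal_extending U N.
Proof.
split=> [Q q eq niq|X Y f g UY fg nsplit|Y UY]; last 1 first.
- exact: (torsion_hom_zero UP) UY WN.2.
- have TQ : T Q by apply: (torsion_epic TP) eq WN.1.
  have [V [Y [v [y [vy UV WY]]]]] := torsion_quotient_W TQ.
  have [yq0|yq0] := EM (y \oc q = 0).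
    have y0 : y = 0 by apply: (iffLR (epicP _) eq).
    have [|w vw] := kernel_lift (u := idm Q) vy.1; first by rewrite y0 comp0m.
    apply: (torsion_epic UP) UV; apply: (@epic_compl _ _ _ v w).
    by rewrite -vw; apply: iso_epic (iso_idm _).
  by case: niq; apply: monic_epic_iso => //; apply: monic_compr (N_to_W_monic WY yq0).
have TX : T X by apply: (torsion_extension TP fg WN.1 (UT UY)).
have [V [Z [v [z [vz UV WZ]]]]] := torsion_quotient_W TX.
have [zZ|nzZ] := EM (is_zero Z).
  apply: (torsion_epic UP) UV; exact: zero_cokernel_epic vz.2 zZ.
have [r er] := W_epic_N WZ nzZ.
have erz := epic_comp er (exact_epic vz).
have rzf0 : (r \oc z) \oc f <> 0.
  move=> /(cokernel_lift fg.2)[h hE]; apply: bN.1; apply: (iffLR (epicP _) erz).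
  by rewrite compm1l hE (torsion_hom_zero UP UY WN.2 h) comp0m.
by case: nsplit; split=> //; apply: retraction_section (bN.2 _ rzf0).
Qed.

Lemma interval_cover : torsion_cover U T.
Proof.
split; [exact: torsion_pair_class UP|exact: torsion_pair_class TP| |].
  rewrite properEneq; split=> //; apply/eqP => UE; apply: bN.1.
  by apply: (torsion_hom_zero UP _ WN.2); rewrite UE; apply: WN.1.
move=> R tR [[UR nRU] [RT nTR]]; apply: nTR => X TX.
have [X' RX'] : exists X', R X' /\ ~ U X'.
  apply: contrapT => /forallNP h; apply: nRU => Y RY.
  by apply: contrapT => nUY; apply: (h Y).
have [_ _ _ Repic] := tR.
have [V [Y [v [y [vy UV WY]]]]] := torsion_quotient_W (RT _ RX'.1).
have nzY : ~ is_zero Y.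
  move=> zY; apply: RX'.2; apply: (torsion_epic UP) UV.
  exact: zero_cokernel_epic vy.2 zY.
have [q eq] := W_epic_N WY nzY.
have RN : R N := Repic _ _ _ (epic_comp eq (exact_epic vy)) RX'.1.
apply: (filtered_torsion (S := U `|` [set N])) tR _ _.
  by move=> Z [/UR|->].
by apply: interval_filtered TX; [move=> Z UZ; apply: filtered1; left|right].
Qed.

End BrickInterval.

(** * The torsion classes of a hom-orthogonal sequence *)

Lemma nth_insert (T : Type) (x0 b : T) (s : seq T) (k i : nat) : (k <= size s)%N ->
  nth x0 (take k s ++ b :: drop k s) i =
  if (i < k)%N then nth x0 s i else if i == k then b else nth x0 s i.-1.
Proof.
move=> lek; rewrite nth_cat size_takel //; case: ltnP => [ltik|leki].
  by rewrite nth_take.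
case: eqVneq => [->|neq]; first by rewrite subnn.
have ltki : (k < i)%N by rewrite ltn_neqAle eq_sym neq.
by case: i ltki {leki neq} => // i ltki; rewrite subSn //= nth_drop subnKC.
Qed.

Lemma perp_right_dsum (Ns : seq A) Y :
  perp_right (dsum Ns) Y <-> forall i, (i < size Ns)%N -> hom_zero (nth zob Ns i) Y.
Proof.
elim: Ns => [|N Ns IH] /=; first by split=> // _; apply: (zobP A).1.
split=> [h [_ f|i /= lti]|h f].
- by rewrite -(compm1r f) -(bproj1_binj1 N (dsum Ns)) compmA (h (f \oc _)) comp0m.
- apply: (iffLR IH) lti => f.
  by rewrite -(compm1r f) -(bproj2_binj2 N (dsum Ns)) compmA (h (f \oc _)) comp0m.
rewrite -(compm1r f) -biprod_id compmDr !compmA.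
by rewrite (h 0%N isT (f \oc _)) (iffRL IH (fun i => h i.+1) (f \oc _)) !comp0m addr0.
Qed.

Definition Nperp (Ns : seq A) (i : nat) : set A :=
  [set Y | forall j, (j <= i)%N -> hom_zero (Nterm Ns j) Y].

Lemma perp_right_Gterm (Ns : seq A) (i : nat) : (i <= size Ns)%N ->
  perp_right (dsum (take i.+1 (zob :: Ns))) = Nperp Ns i.
Proof.
move=> lei; have sz : size (take i.+1 (zob :: Ns)) = i.+1 by rewrite size_takel.
apply/seteqP; split=> Y.
  move=> /perp_right_dsum; rewrite sz => h j leji.
  by have := h j; rewrite nth_take //; apply.
by move=> h; apply/perp_right_dsum => j; rewrite sz => ltj; rewrite nth_take //; apply: h.
Qed.

Lemma Gterm_torsion_pair (Ns : seq A) (i : nat) :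
  length_category A -> (i <= size Ns)%N -> torsion_pair (Gterm Ns i) (Nperp Ns i).
Proof.
by move=> lenA lei; rewrite -perp_right_Gterm //; apply: Gcal_torsion_pair.
Qed.

Lemma Nterm_Gterm (Ns : seq A) (i j : nat) :
  (j <= i)%N -> (i <= size Ns)%N -> Gterm Ns i (Nterm Ns j).
Proof. by move=> leji lei Y; rewrite perp_right_Gterm //; apply. Qed.

(** Otherwise B could be inserted just before N_(i+1), in position i of the list. *)
Lemma Gterm_heart_brick (Ns : seq A) (i : nat) (B : A) :
  complete_forward_hom_orthogonal Ns -> (i < size Ns)%N ->
  brick B -> Gterm Ns i.+1 B -> Nperp Ns i B ->
  hom_zero B (Nterm Ns i.+1) -> isomorphic B (Nterm Ns i.+1).
Proof.
move=> [bNs orth maxN GA] lti bB GB FB BN; apply: contrapT => nBN.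
have fromN j : (j < i)%N -> hom_zero (nth zob Ns j) B by move=> /FB.
have toN k : (i <= k < size Ns)%N -> hom_zero B (nth zob Ns k).
  move=> /andP[]; rewrite leq_eqVlt => /predU1P[<- //|ltik ltk].
  apply: GB; rewrite perp_right_Gterm // => -[|j] ltj /=.
    by apply: (zobP A).1.
  by apply: orth; rewrite ltk (leq_ltn_trans _ ltik).
have notiso X Y : brick X -> hom_zero X Y -> ~ isomorphic X Y.
  move=> bX XY [f jf]; apply: bX.1; apply: (iffLR (monicP _) (iso_monic jf)).
  by rewrite compm1r; apply: XY.
apply: (maxN B i bB _ _ (ltnW lti)); first by rewrite GA.
  move=> j ltj; have [ltji|leij] := ltnP j i; last first.
    by apply: notiso => //; apply: toN; rewrite leij.
  by move=> /isomorphic_sym; apply: notiso (fromN _ ltji); apply: bNs.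
move=> a b; rewrite !nth_insert ?(ltnW lti) // size_cat size_takel ?(ltnW lti) //=.
rewrite size_drop addnS subnKC ?(ltnW lti) // ltnS => /andP[ltab leb].
case: (ltngtP b i) => [ltbi|ltib|eqbi].
- by rewrite (ltn_trans ltab ltbi); apply: orth; rewrite ltab (ltn_trans ltbi).
- (* Entries after B are shifted by one. *)
  case: b ltab leb ltib => // b ltab ltb leib /=.
  case: (ltngtP a i) => [ltai|ltia|_].
  + by apply: orth; rewrite ltb andbT (leq_trans ltai).
  + by apply: orth; rewrite ltb andbT; case: a ltia ltab.
  + by apply: toN; rewrite ltb andbT.
- by rewrite -eqbi ltab; apply: fromN; rewrite -eqbi.
Qed.

Lemma Gterm_step (Ns : seq A) (i : nat) :
  length_category A -> complete_forward_hom_orthogonal Ns -> (i < size Ns)%N ->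
  [/\ minimal_extending (Gterm Ns i) (Nterm Ns i.+1),
      forall (S : set A) X, (forall Y, Gterm Ns i Y -> filtered S Y) ->
        S (Nterm Ns i.+1) -> Gterm Ns i.+1 X -> filtered S X
    & torsion_cover (Gterm Ns i) (Gterm Ns i.+1)].
Proof.
move=> lenA hNs lti; have [ell ellP] := superadditive_length_exists lenA.
have UP := Gterm_torsion_pair lenA (ltnW lti).
have TP := Gterm_torsion_pair lenA lti.
have [bNs orth _ _] := hNs; have bN : brick (Nterm Ns i.+1) := bNs i lti.
have UT : Gterm Ns i `<=` Gterm Ns i.+1.
  have [UE _ _] := UP; have [TE _ _] := TP.
  move=> X /UE GX; apply/TE => Y FY; apply: GX => j leji.
  exact: FY (leqW leji).
have WN : (Gterm Ns i.+1 `&` Nperp Ns i) (Nterm Ns i.+1).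
  split; first exact: Nterm_Gterm.
  case=> [_|j ltji]; first exact: (zobP A).1.
  by apply: orth; rewrite ltji lti.
have fromN X : (Gterm Ns i.+1 `&` Nperp Ns i) X ->
    hom_zero (Nterm Ns i.+1) X -> is_zero X.
  move=> [TX FX] NX; apply: (torsion_torsionfree_zero TP TX) => j.
  by rewrite leq_eqVlt => /predU1P[->|/FX].
have toN B : brick B -> (Gterm Ns i.+1 `&` Nperp Ns i) B ->
    hom_zero B (Nterm Ns i.+1) -> isomorphic B (Nterm Ns i.+1).
  by move=> bB [TB FB]; apply: Gterm_heart_brick.
split.
- exact: interval_minimal_extending ellP UP TP UT bN WN fromN toN.
- by move=> S X; apply: (interval_filtered ellP UP TP UT bN WN fromN toN).
- exact: interval_cover ellP UP TP UT bN WN fromN toN.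
Qed.

Lemma Gterm0 (Ns : seq A) : Gterm Ns 0 = [set X | is_zero X].
Proof.
apply/seteqP; split=> X; last by move=> [zX _] Y _; apply: zX.
move=> GX; apply/is_zeroP/GX; rewrite perp_right_Gterm // => -[|//] _ /=.
exact: (zobP A).1.
Qed.

Lemma Gterm_filtered (Ns : seq A) (i : nat) :
  length_category A -> complete_forward_hom_orthogonal Ns -> (i <= size Ns)%N ->
  Gterm Ns i = Filt [set X | exists2 j : nat, (j <= i)%N & X = Nterm Ns j].
Proof.
move=> lenA hNs lei; apply/seteqP; split=> X; last first.
  have TP := Gterm_torsion_pair lenA lei.
  apply: (filtered_torsion (torsion_pair_class TP)) => _ [[j leji ->] _].
  exact: Nterm_Gterm.
elim: i X lei => [X _|i IH X lti]; first by rewrite Gterm0; apply: filtered_zero.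
have [_ step _] := Gterm_step lenA hNs lti; apply: step.
  move=> Y /(IH _ (ltnW lti)); apply: filtered_sub => Z [[j leji ->] iZ].
  by apply: filtered1; split=> //; exists j => //; apply: leqW.
split; first by exists i.+1.
by have [bNs _ _ _] := hNs; apply/brick_indecomposable/bNs.
Qed.

End Chase.

Theorem theorem2p12 (A : abelian_category) (hA : length_category A) (Ns : seq A)
    (hNs : complete_forward_hom_orthogonal Ns) :
  [/\ forall i : nat, (i <= size Ns)%N ->
        Gterm Ns i = Filt [set X | exists2 j : nat, (j <= i)%N & X = Nterm Ns j],
      forall i : nat, (1 <= i <= size Ns)%N ->
        minimal_extending (Gterm Ns i.-1) (Nterm Ns i) /\
        Gterm Ns i = Filt (Gterm Ns i.-1 `|` [set Nterm Ns i])
    & maximal_green_sequence (size Ns) (Gterm Ns)].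
Proof.
split; first by move=> i; apply: Gterm_filtered.
- case=> // i lti /=; have [minN step [_ _ /properW UT _]] := Gterm_step hA hNs lti.
  split=> //; apply/seteqP; split=> X.
    apply: step.
      move=> Y; rewrite {1}(Gterm_filtered hA hNs (ltnW lti)).
      apply: filtered_sub => _ [[j leji ->] iN].
      by apply: filtered1; split=> //; left; apply: Nterm_Gterm (ltnW lti).
    split; first by right.
    by have [bNs _ _ _] := hNs; apply/brick_indecomposable/bNs.
  have TP := Gterm_torsion_pair hA lti.
  apply: (filtered_torsion (torsion_pair_class TP)) => Y [[/UT //|->] _].
  exact: Nterm_Gterm.
- split.
  + by move=> i lei; apply: torsion_pair_class (Gterm_torsion_pair hA lei).
  + exact: Gterm0.
  + have [_ _ _ GA] := hNs.
    apply/seteqP; split=> // X _; have [TE _ _] := Gterm_torsion_pair hA (leqnn (size Ns)).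
    apply/TE => Y FY; have : Gcal (dsum Ns) X by rewrite GA.
    by apply; apply/perp_right_dsum => j ltj; apply: (FY j.+1).
  + by move=> i lti; have [] := Gterm_step hA hNs lti.
Qed.
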